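(* Let $\gamma$ be a complex number. For all positive integers $a$ and $k$, \[ \sigma_{-\gamma}(a;k)=k^{\gamma}\sum_{\substack{(k_1,\dots,k_a)\in\mathbb{Z}_{>0}^a\\ k_1k_2\cdots k_a=k}}\frac{1}{k_1^{\gamma}\,k_2^{2\gamma}\cdots k_a^{a\gamma}}, \] the sum running over all ordered $a$-tuples of positive integers whose product is $k$.
   Context: For a positive integer $n$, $\sigma_{-\gamma}(n)=\sum_{d\mid n} d^{-\gamma}$. For positive integers $a$ and $k$, define \[ \sigma_{-\gamma}(a;k)=\prod_{j=0}^{a-2}\frac{\sigma_{-\gamma}\!\left(k\prod_{p\mid k}p^{j}\right)}{\sigma_{-\gamma}\!\left(\prod_{p\mid k}p^{j}\right)}, \] where $\prod_{p\mid k}$ runs over the distinct primes dividing $k$; this is defined to be $1$ when $a=1$ (empty product), and it equals $1$ when $k=1$.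
   Formalization: Where a denominator σ_{-γ}(∏_{p|k} p^j) vanishes (e.g. k=2, a=3, 2^{-γ}=-1) the product defining σ_{-γ}(a;k) is undefined; there it is taken to be the limit of the same product as z→γ, z≠γ. For all other γ it is the product as written. *)

(* Defs.v *)
From mathcomp Require Import all_boot all_order all_algebra.
From mathcomp Require Import complex.
From mathcomp Require Import all_classical all_reals all_analysis.

Set Implicit Arguments.
Unset Strict Implicit.
Unset Printing Implicit Defensive.

Import Order.TTheory GRing.Theory Num.Theory.
Import numFieldNormedType.Exports.

Local Open Scope classical_set_scope.
Local Open Scope ring_scope.
Local Open Scope complex_scope.

(* n ^ s = exp (s * ln n), with the real logarithm; meaningful for n > 0. *)
Definition natpow (R : realType) (n : nat) (s : R[i]) : R[i] :=
  let x : R := ln (n%:R : R) in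
  (expR (complex.Re s * x))%:C
    * (cos (complex.Im s * x) +i* sin (complex.Im s * x)).

(* sigma_{-g}(n) *)
Definition sigma (R : realType) (g : R[i]) (n : nat) : R[i] :=
  \sum_(d <- divisors n) natpow d (- g).

Definition primes_pow (k j : nat) : nat := (\prod_(p <- primes k) p ^ j)%N.

(* The displayed quotient, for j = 0, ..., a - 2; '/ 0' is '* 0' here. *)
Definition sigma_quotient (R : realType) (a k : nat) (g : R[i]) : R[i] :=
  \prod_(j < a.-1)
    (sigma g (k * primes_pow k j) / sigma g (primes_pow k j)).

(* sigma_{-g}(a; k).  At an isolated set of g (e.g. p^(-g) = -1, a >= 3, p | k)
   a denominator sigma_{-g}(prod_(p | k) p^j) vanishes, and the quotient is
   undefined as written.  All these singularities are removable; there the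
   value is the limit of the same quotient at z -> g, z != g. *)
Definition sigma_ak (R : realType) (a k : nat) (g : R[i]) : R[i] :=
  if [forall j : 'I_a.-1, sigma g (primes_pow k j) != 0]
  then sigma_quotient a k g
  else lim (sigma_quotient a k z @[z --> (g : R[i]^o)^'] : set_system R[i]^o).

(* Main.v *)
(** Write x(n) = n^(-gamma), a completely multiplicative function.  Distributing
    k^gamma = k_1^gamma ... k_a^gamma, the right-hand side becomes
    D_a(k) = sum over k_1 ... k_a = k of x(k_2) x(k_3)^2 ... x(k_a)^(a-1), so that
    D_(a+1)(k) = sum over d | k of x(d)^a D_a(k/d).  Everything reduces to
      D_(a+2)(k) sigma(rad(k)^a) = D_(a+1)(k) sigma(k rad(k)^a),
    both sides of which are multiplicative in k.  At k = p^e, D_a(p^e) is the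
    Gaussian binomial coefficient [e+a-1 choose e] in x(p), and the identity is
    the ratio of consecutive Gaussian binomials.  Multiplying these ratios
    settles every gamma where no denominator vanishes.  Zeros of the
    denominators are isolated and the right-hand side is continuous in gamma, so
    the limit defining the left-hand side at the exceptional gamma is also the
    right-hand side. *)

Require Import Defs.
From mathcomp Require Import ring.
From mathcomp Require Import all_boot all_order all_algebra.
From mathcomp Require Import complex.
From mathcomp Require Import all_classical all_reals all_analysis.

Set Implicit Arguments.
Unset Strict Implicit.
Unset Printing Implicit Defensive.

Import Order.TTheory GRing.Theory Num.Theory.
Import numFieldNormedType.Exports.
Local Open Scope classical_set_scope.
Local Open Scope ring_scope.
Local Open Scope complex_scope.

(** * Divisors, prime factorizations and radicals *)

(** Splitting off the full power of the smallest prime divisor leaves a smaller coprime cofactor.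
    Identities between multiplicative functions thus reduce to prime powers. *)
Lemma coprime_prime_ind (P : nat -> Prop) :
  P 1%N ->
  (forall p e n, prime p -> (0 < e)%N -> (0 < n)%N -> coprime (p ^ e) n ->
     P n -> P (p ^ e * n)%N) ->
  forall n, (0 < n)%N -> P n.
Proof.
move=> P1 PM n; elim/ltn_ind: n => n IH n0.
have [->//|n1] := eqVneq n 1%N.
have n2 : (1 < n)%N by rewrite ltn_neqAle eq_sym n1.
have pp := pdiv_prime n2.
set p := pdiv n in pp.
rewrite -(partnC p n0) p_part.
have e0 : (0 < logn p n)%N by rewrite logn_gt0 mem_primes pp n0 pdiv_dvd.
apply: PM => //; first by rewrite -p_part coprime_partC.
apply: IH => //.
rewrite -[ltnRHS](partnC p n0) p_part ltn_Pmull //.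
by rewrite -[1%N](exp1n (logn p n)) ltn_exp2r // prime_gt1.
Qed.

Lemma perm_divisors_coprime (m n : nat) : (0 < m)%N -> (0 < n)%N -> coprime m n ->
  perm_eq (divisors (m * n)) [seq (d * e)%N | d <- divisors m, e <- divisors n].
Proof.
move=> m0 n0 cmn; apply: uniq_perm; first exact: divisors_uniq.
  apply: allpairs_uniq; rewrite ?divisors_uniq // => -[d e] [d' e'] /=.
  case/allpairsP => -[d1 e1] /= [+ + [-> ->]].
  rewrite -!dvdn_divisors // => dm en.
  case/allpairsP => -[d2 e2] /= [+ + [-> ->]].
  rewrite -!dvdn_divisors // => dm' en' E.
  have cop u v : (u %| m)%N -> (v %| n)%N -> coprime u v.
    by move=> um vn; apply: coprime_dvdl um _; apply: coprime_dvdr vn _.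
  (* By Gauss's lemma, each of [d1] and [d2] divides the other, being coprime to the opposite
     cofactor. *)
  have dd : d1 = d2.
    apply/eqP; rewrite eqn_dvd -(@Gauss_dvdl d1 d2 e2) ?cop // -E dvdn_mulr //=.
    by rewrite -(@Gauss_dvdl d2 d1 e1) ?cop // E dvdn_mulr.
  have d20 : (0 < d2)%N by apply: dvdn_gt0 dm'.
  by move: E; rewrite dd => /eqP; rewrite eqn_pmul2l // => /eqP ->.
move=> d; rewrite -dvdn_divisors ?muln_gt0 ?m0 //; apply/idP/allpairsP.
  (* The part of [d] shared with [m] and the part shared with [n] are coprime, and their product is
     [d]. *)
  move=> dmn; exists (gcdn d m, gcdn d n); rewrite -!dvdn_divisors // !dvdn_gcdr.
  split=> //=.
  apply/eqP; rewrite eqn_dvd; apply/andP; split.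
    by rewrite muln_gcdr dvdn_gcd dvdn_mull // muln_gcdl dvdn_gcd dvdn_mulr.
  rewrite Gauss_dvd ?dvdn_gcdl //.
  exact: coprime_dvdl (dvdn_gcdr _ _) (coprime_dvdr (dvdn_gcdr _ _) cmn).
case=> -[u v] /= []; rewrite -!dvdn_divisors // => um vn ->; exact: dvdn_mul.
Qed.

Lemma sum_divisors_coprime (V : nmodType) (f : nat -> V) m n :
  (0 < m)%N -> (0 < n)%N -> coprime m n ->
  \sum_(d <- divisors (m * n)) f d =
  \sum_(d <- divisors m) \sum_(e <- divisors n) f (d * e)%N.
Proof.
move=> m0 n0 cmn.
rewrite (perm_big _ (perm_divisors_coprime m0 n0 cmn)) /=.
by rewrite big_allpairs_dep.
Qed.

Lemma perm_divisors_pfactor (p e : nat) : prime p ->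
  perm_eq (divisors (p ^ e)) [seq (p ^ i)%N | i <- index_iota 0 e.+1].
Proof.
move=> pp; apply: uniq_perm; first exact: divisors_uniq.
  rewrite map_inj_uniq ?iota_uniq //; exact: (expnI (prime_gt1 pp)).
move=> d; rewrite -dvdn_divisors ?expn_gt0 ?prime_gt0 //.
apply/dvdn_pfactor/mapP => // -[j].
  by move=> je ->; exists j; rewrite ?mem_index_iota.
by rewrite mem_index_iota => je ->; exists j.
Qed.

Lemma primes_pow_mul m n j : (0 < m)%N -> (0 < n)%N -> coprime m n ->
  primes_pow (m * n)%N j = (primes_pow m j * primes_pow n j)%N.
Proof.
move=> m0 n0 cmn; rewrite /primes_pow -big_cat; apply: perm_big.
apply: uniq_perm; rewrite ?cat_uniq ?primes_uniq ?andbT //=.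
  by rewrite -coprime_has_primes // coprime_sym.
by move=> p; rewrite mem_cat primesM.
Qed.

Lemma primes_pow_pfactor p e j : prime p -> (0 < e)%N ->
  primes_pow (p ^ e)%N j = (p ^ j)%N.
Proof. by move=> pp e0; rewrite /primes_pow primesX // primes_prime // big_seq1. Qed.

Lemma primes_pow_gt0 n j : (0 < primes_pow n j)%N.
Proof.
rewrite /primes_pow big_seq prodn_cond_gt0 // => p; rewrite mem_primes.
by case/and3P=> pp _ _; rewrite expn_gt0 prime_gt0.
Qed.

Lemma primes_pow1 j : primes_pow 1%N j = 1%N.
Proof. by rewrite /primes_pow big_nil. Qed.

Lemma coprime_primes_pow m n j : (0 < m)%N -> (0 < n)%N -> coprime m n ->
  coprime m (primes_pow n j).
Proof.
move=> m0 n0 cmn; rewrite /primes_pow big_seq coprime_sym.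
apply: (big_ind (fun k => coprime k m)) => [|u v|p]; first exact: coprime1n.
  by move=> cu cv; rewrite coprimeMl cu.
rewrite mem_primes => /and3P[pp _ pn]; apply: coprimeXl.
by rewrite coprime_sym; apply: coprime_dvdr pn _.
Qed.

(** * Geometric sums and weighted sums over factorizations *)

Definition geometric_sum (F : nzRingType) (y : F) (n : nat) : F := \sum_(i < n) y ^+ i.

Lemma geometric_sumD (F : nzRingType) (y : F) m n :
  geometric_sum y (m + n)%N = geometric_sum y m + y ^+ m * geometric_sum y n.
Proof.
rewrite /geometric_sum big_split_ord /= big_distrr; congr (_ + _).
by apply: eq_bigr => i _; rewrite exprD.
Qed.

Section FactorSum.
Variables (F : comNzRingType) (x : nat -> F).
Hypothesis x1 : x 1%N = 1.
Hypothesis xM : forall m n, (0 < m)%N -> (0 < n)%N -> x (m * n)%N = x m * x n.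

Definition divisor_sum n : F := \sum_(d <- divisors n) x d.

(** This is D_a(n), built by choosing the last factor [d] first; with positions counted from 0, the
    factor at position b has weight [x d ^+ b]. *)
Fixpoint factor_sum a n : F :=
  if a is b.+1 then \sum_(d <- divisors n) x d ^+ b * factor_sum b (n %/ d)%N
  else (n == 1%N)%:R.

Lemma divisor_sumM m n : (0 < m)%N -> (0 < n)%N -> coprime m n ->
  divisor_sum (m * n)%N = divisor_sum m * divisor_sum n.
Proof.
move=> m0 n0 cmn; rewrite /divisor_sum sum_divisors_coprime // big_distrl.
apply: eq_big_seq => d; rewrite -dvdn_divisors // => dm.
rewrite big_distrr; apply: eq_big_seq => e; rewrite -dvdn_divisors // => en.
by rewrite xM ?(dvdn_gt0 _ dm) ?(dvdn_gt0 _ en).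
Qed.

Lemma factor_sumM a m n : (0 < m)%N -> (0 < n)%N -> coprime m n ->
  factor_sum a (m * n)%N = factor_sum a m * factor_sum a n.
Proof.
elim: a m n => [|a IH] m n m0 n0 cmn /=.
  by rewrite -natrM mulnb muln_eq1.
rewrite sum_divisors_coprime // big_distrl.
apply: eq_big_seq => d; rewrite -dvdn_divisors // => dm.
rewrite big_distrr; apply: eq_big_seq => e; rewrite -dvdn_divisors // => en.
have d0 := dvdn_gt0 m0 dm; have e0 := dvdn_gt0 n0 en.
rewrite xM //.
have -> : (m * n %/ (d * e) = (m %/ d) * (n %/ e))%N.
  by rewrite -{1}(divnK dm) -{1}(divnK en) mulnACA mulnK // muln_gt0 d0.
rewrite IH ?divn_gt0 ?(dvdn_leq _ dm) ?(dvdn_leq _ en) // ?exprMn.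
  by rewrite mulrACA.
exact: coprime_dvdl (dvdn_div dm) (coprime_dvdr (dvdn_div en) cmn).
Qed.

Lemma comp_multX p i : (0 < p)%N -> x (p ^ i)%N = x p ^+ i.
Proof.
move=> p0; elim: i => [|i IH]; first by rewrite expr0.
by rewrite expnS exprS xM ?expn_gt0 ?p0 // IH.
Qed.

Lemma divisor_sum_pfactor p e : prime p ->
  divisor_sum (p ^ e)%N = geometric_sum (x p) e.+1.
Proof.
move=> pp; rewrite /divisor_sum (perm_big _ (perm_divisors_pfactor e pp)) big_map.
rewrite big_mkord.
by apply: eq_bigr => i _; rewrite comp_multX ?prime_gt0.
Qed.

Lemma factor_sum_pfactorS p a e : prime p ->
  factor_sum a.+1 (p ^ e)%N =
  \sum_(i < e.+1) x p ^+ (i * a) * factor_sum a (p ^ (e - i))%N.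
Proof.
move=> pp; rewrite /= (perm_big _ (perm_divisors_pfactor e pp)) big_map.
rewrite big_mkord.
apply: eq_bigr => i _; rewrite comp_multX ?prime_gt0 // -exprM.
by rewrite -expnB ?prime_gt0 // -ltnS.
Qed.

(** Pascal's rule for Gaussian binomials: either the last factor is 1, or one [p] is removed from it
    at the cost of [x p ^+ a]. *)
Lemma factor_sum_pfactor_rec p a e : prime p ->
  factor_sum a.+1 (p ^ e.+1)%N =
  factor_sum a (p ^ e.+1)%N + x p ^+ a * factor_sum a.+1 (p ^ e)%N.
Proof.
move=> pp; rewrite !factor_sum_pfactorS // big_ord_recl /= mul0n expr0 mul1r subn0.
congr (_ + _); rewrite big_distrr; apply: eq_bigr => i _ /=.
by rewrite /bump /= add1n mulSn exprD mulrA subSS.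
Qed.

Lemma factor_sum1 a : factor_sum a 1%N = 1.
Proof. by elim: a => [|a IH] //=; rewrite big_seq1 x1 expr1n mul1r divn1. Qed.

(** The ratio of consecutive Gaussian binomials, cross-multiplied because a geometric sum may
    vanish. *)
Lemma factor_sum_pfactor_ratio p a e : prime p ->
  geometric_sum (x p) a * factor_sum a.+1 (p ^ e)%N =
  geometric_sum (x p) (a + e)%N * factor_sum a (p ^ e)%N.
Proof.
move=> pp.
(* The recursion on exponents turns [a] h(a+1,e) = [e+1] h(a,e+1), with
   [n] = geometric_sum (x p) n and h(a,e) = factor_sum a (p ^ e), into the claim
   at exponent e+1; the former is then obtained by induction on a. *)
have step b f :
    geometric_sum (x p) b * factor_sum b.+1 (p ^ f)%N =
      geometric_sum (x p) f.+1 * factor_sum b (p ^ f.+1)%N ->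
    geometric_sum (x p) b * factor_sum b.+1 (p ^ f.+1)%N =
      geometric_sum (x p) (b + f.+1)%N * factor_sum b (p ^ f.+1)%N.
  by move=> E; rewrite factor_sum_pfactor_rec // mulrDr mulrCA E geometric_sumD; ring.
elim: e a => [|e IHe] a; first by rewrite expn0 !factor_sum1 addn0.
apply: step; elim: a => [|a IHa].
  rewrite /= [geometric_sum (x p) 0]big_ord0 mul0r.
  by rewrite -[1%N](expn0 p) eqn_exp2l ?prime_gt1 // mulr0.
(* Both sides become multiples of h(a+1,e), and the coefficients agree by [a+e+1] = [a] + y^a [e+1]
   with y = [x p]. *)
rewrite IHe factor_sum_pfactor_rec // mulrDr -IHa.
by rewrite addSnnS geometric_sumD mulrDl mulrCA mulrA.
Qed.

Lemma factor_sum_ratio a k : (0 < k)%N ->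
  factor_sum a.+2 k * divisor_sum (primes_pow k a) =
  factor_sum a.+1 k * divisor_sum (k * primes_pow k a)%N.
Proof.
move: k; apply: coprime_prime_ind => [|p e n pp e0 n0 cpn IH].
  by rewrite !factor_sum1 primes_pow1.
have q0 : (0 < p ^ e)%N by rewrite expn_gt0 prime_gt0.
have cn : coprime p n by move: cpn; rewrite coprime_pexpl.
have p0 f : (0 < p ^ f)%N by rewrite expn_gt0 prime_gt0.
rewrite !factor_sumM // primes_pow_mul // primes_pow_pfactor //.
(* The exponent a+e is written as a predecessor so that its divisor sum is the geometric sum of
   length [a.+1 + e] in [factor_sum_pfactor_ratio]. *)
have -> : (p ^ e * n * (p ^ a * primes_pow n a) =
  p ^ (a.+1 + e).-1 * (n * primes_pow n a))%N.
  by rewrite addSn /= addnC expnD mulnACA.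
have n'0 := primes_pow_gt0 n a.
have cp f : coprime (p ^ f) (primes_pow n a).
  exact: coprimeXl (coprime_primes_pow _ (prime_gt0 pp) n0 cn).
rewrite divisor_sumM // [divisor_sum (p ^ _ * (n * _))%N]divisor_sumM
  ?muln_gt0 ?n0 ?coprimeMr ?cp ?coprimeXl //.
rewrite mulrACA IH !divisor_sum_pfactor //.
rewrite [X in X * _ = _]mulrC -/(geometric_sum (x p) a.+1).
rewrite factor_sum_pfactor_ratio // addSn.
rewrite /geometric_sum; ring.
Qed.

End FactorSum.

(** * Ordered factorizations as finite functions *)

Lemma sum_divisors_ord (V : nmodType) (f : nat -> V) N m : (0 < m)%N -> (m <= N)%N ->
  \sum_(d <- divisors m) f d = \sum_(d < N.+1 | (0 < d)%N && (d %| m)%N) f d.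
Proof.
move=> m0 mN.
rewrite -(big_mkord (fun d => (0 < d)%N && (d %| m)%N)) -[RHS]big_filter; apply: perm_big.
apply: uniq_perm; rewrite ?divisors_uniq ?filter_uniq ?iota_uniq // => d.
rewrite mem_filter mem_index_iota -dvdn_divisors //.
case: (boolP (d %| m)%N) => [dm|]; rewrite ?andbF //= andbT.
by rewrite (dvdn_gt0 m0 dm) ltnS (leq_trans (dvdn_leq m0 dm)).
Qed.

Lemma widen_ord_max n (i : 'I_n) : widen_ord (leqnSn n) i = lift ord_max i.
Proof. by apply: val_inj; rewrite /= /bump leqNgt ltn_ord. Qed.

Section TupleSum.
Variables (F : comNzRingType) (x : nat -> F).

(** The bound [N] is kept apart from [m]: the induction splits off the last entry [d] and passes to
    [m %/ d] with the same codomain. *)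
Lemma sum_ffun_factor a N m : (0 < m)%N -> (m <= N)%N ->
  \sum_(t : {ffun 'I_a -> 'I_N.+1} |
        [forall i, (0 < t i)%N] && ((\prod_(i < a) (t i : nat))%N == m))
    \prod_(i < a) x (t i) ^+ i = factor_sum x a m.
Proof.
elim: a m => [|a IH] m m0 mN.
  have t0 : {ffun 'I_0 -> 'I_N.+1} by exact: [ffun _ => ord0].
  rewrite /= (eq_bigl (fun t => (m == 1%N) && (t == t0))); last first.
    move=> t; rewrite big_ord0 eq_sym.
    have -> : t = t0 by apply/ffunP => -[].
    by rewrite eqxx andbT; apply/andb_idl => _; apply/forallP => -[].
  under eq_bigr do rewrite big_ord0.
  by case: (m == 1%N); rewrite /= ?big_pred1_eq ?big_pred0.
(* [h] appends a last entry to a tuple, and [g] is its inverse. *)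
pose h (p : 'I_N.+1 * {ffun 'I_a -> 'I_N.+1}) : {ffun 'I_a.+1 -> 'I_N.+1} :=
  [ffun i => if unlift ord_max i is Some j then p.2 j else p.1].
pose g (t : {ffun 'I_a.+1 -> 'I_N.+1}) := (t ord_max, [ffun j => t (lift ord_max j)]).
have hm p : h p ord_max = p.1 by rewrite ffunE unlift_none.
have hl p j : h p (lift ord_max j) = p.2 j by rewrite ffunE liftK.
rewrite (reindex h) /=; last first.
  exists g => [[d t] _|t _].
    by rewrite /g hm; congr pair; apply/ffunP => j; rewrite ffunE hl.
  apply/ffunP => i; rewrite ffunE; case: unliftP => [j ->|->] //=.
  by rewrite ffunE.
rewrite (eq_bigl (fun p : 'I_N.+1 * {ffun 'I_a -> 'I_N.+1} =>
   ((0 < p.1)%N && (p.1 %| m)%N) &&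
   ([forall i, (0 < p.2 i)%N] &&
      ((\prod_(i < a) (p.2 i : nat))%N == (m %/ p.1)%N)))); last first.
  move=> [d t] /=; rewrite big_ord_recr /= hm /=.
  under eq_bigr do rewrite widen_ord_max hl /=.
  have -> : [forall i, 0 < h (d, t) i]%N = (0 < d)%N && [forall i, 0 < t i]%N.
    apply/forallP/andP => [H|[d0 /forallP H] i].
      split; first by have := H ord_max; rewrite hm.
      by apply/forallP => i; have := H (lift ord_max i); rewrite hl.
    by rewrite ffunE; case: unliftP => [j _|_] /=; first exact: H.
  rewrite -!andbA; case: (boolP (0 < d)%N) => //= d0.
  rewrite andbCA; congr andb; apply/eqP/andP => [<-|[dm /eqP ->]].
    by rewrite dvdn_mull // mulnK.
  by rewrite divnK.
rewrite (eq_bigr (fun p : 'I_N.+1 * {ffun 'I_a -> 'I_N.+1} =>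
  x p.1 ^+ a * \prod_(i < a) x (p.2 i) ^+ i)); last first.
  move=> p _; rewrite big_ord_recr /= hm mulrC; congr (_ * _).
  by apply: eq_bigr => i _; rewrite widen_ord_max hl.
rewrite -(pair_big_dep (fun d : 'I_N.+1 => (0 < d)%N && (d %| m)%N)
  (fun d (t : {ffun 'I_a -> 'I_N.+1}) => [forall i, (0 < t i)%N] &&
      ((\prod_(i < a) (t i : nat))%N == (m %/ d)%N))
  (fun d t => x d ^+ a * \prod_(i < a) x (t i) ^+ i)) /=.
rewrite (sum_divisors_ord _ m0 mN); apply: eq_bigr => d /andP[d0 dm].
rewrite -big_distrr /= IH ?divn_gt0 ?(dvdn_leq _ dm) //.
by rewrite (leq_trans (leq_div _ _)).
Qed.

End TupleSum.

(** * Complex powers: algebra, continuity and isolated solutions *)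

Section ComplexExp.
Variable R : realType.
Implicit Types (s z w : R[i]) (n : nat).

Definition cexp z : R[i] :=
  (expR (complex.Re z))%:C * (cos (complex.Im z) +i* sin (complex.Im z)).

Lemma natpowE n s : natpow n s = cexp (s * (ln (n%:R : R))%:C).
Proof. by case: s => a b; rewrite /natpow /cexp /= !mulr0 subr0 add0r. Qed.

Lemma cexp0 : cexp 0 = 1.
Proof. by rewrite /cexp /= expR0 cos0 sin0 mul1r. Qed.

Lemma cexpD z w : cexp (z + w) = cexp z * cexp w.
Proof.
case: z w => [a b] [c d]; rewrite /cexp /= expRD cosD sinD.
by apply/eqP; rewrite eq_complex /=; apply/andP; split; apply/eqP; ring.
Qed.

Lemma natpowD n s z : natpow n (s + z) = natpow n s * natpow n z.
Proof. by rewrite !natpowE mulrDl cexpD. Qed.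

Lemma natpow0 n : natpow n 0 = 1 :> R[i].
Proof. by rewrite natpowE mul0r cexp0. Qed.

Lemma natpow1 s : natpow 1 s = 1.
Proof. by rewrite natpowE ln1 mulr0 cexp0. Qed.

Lemma natpowM m n s : (0 < m)%N -> (0 < n)%N ->
  natpow (m * n) s = natpow m s * natpow n s.
Proof.
move=> m0 n0; rewrite !natpowE natrM lnM ?posrE ?ltr0n //.
by rewrite rmorphD mulrDr cexpD.
Qed.

Lemma natpowMn n m s : natpow n (m%:R * s) = natpow n s ^+ m.
Proof.
elim: m => [|m IH]; first by rewrite mul0r natpow0.
by rewrite -addn1 natrD mulrDl mul1r natpowD IH exprD.
Qed.

Lemma natpow_neq0 n s : natpow n s != 0.
Proof.
apply/eqP => E; have := natpow0 n; rewrite -(subrr s) natpowD E mul0r.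
by move/esym/eqP; rewrite oner_eq0.
Qed.

Lemma natpowN n s : natpow n (- s) = (natpow n s)^-1.
Proof.
by apply: (mulfI (natpow_neq0 n s)); rewrite -natpowD subrr natpow0 divff ?natpow_neq0.
Qed.

(** The kernel of the exponential is discrete. A vanishing sine and a positive cosine force cos b =
    1, whence the real part is 0. *)
Lemma cexp_eq1 z : cexp z = 1 -> `|complex.Im z| < pi -> z = 0.
Proof.
case: z => a b; rewrite /cexp /= => /eqP.
rewrite eq_complex /= !mul0r subr0 addr0 => /andP[/eqP Ec /eqP Es] bpi.
have e0 := expR_gt0 a.
have sb : sin b = 0 by move/eqP: Es; rewrite mulf_eq0 gt_eqF //= => /eqP.
have cb0 : 0 < cos b by rewrite -(pmulr_rgt0 _ e0) Ec.
have cb : cos b = 1.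
  by have := sin0cos1 sb; rewrite gtr0_norm.
have a0 : a = 0.
  by move: Ec; rewrite cb mulr1 -expR0 => /expR_inj.
suff: `|b| = 0 by move/normr0P/eqP => b0; rewrite a0 b0.
(* Cosine is injective on [0, pi], hence the comparison of |b|, rather than b, with 0. *)
apply: cos_inj; rewrite ?in_itv /= ?lexx ?pi_ge0 ?normr_ge0 ?(ltW bpi) //.
by rewrite cos0 cos_norm.
Qed.

Lemma Re_continuous : continuous (@complex.Re R : R[i]^o -> R).
Proof.
move=> g; apply/(@cvgrPdist_lt R R^o R[i]^o (nbhs (g : R[i]^o))) => e e0.
near=> z.
have -> : complex.Re g - complex.Re z = complex.Re (g - z).
  by case: (g) (z) => a b [c d].
rewrite -ltcR; apply: le_lt_trans (normc_ge_Re (g - z)) _.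
near: z; apply: (@cvgr_dist_lt _ R[i]^o); last by rewrite ltcR.
exact: cvg_id.
Unshelve. all: by end_near. Qed.

Lemma Im_continuous : continuous (@complex.Im R : R[i]^o -> R).
Proof.
move=> g; apply/(@cvgrPdist_lt R R^o R[i]^o (nbhs (g : R[i]^o))) => e e0.
near=> z.
(* Multiplication by ['i] preserves the norm and reduces the estimate to the one for real parts. *)
have -> : complex.Im g - complex.Im z = - complex.Re ((g - z) * 'i).
  by case: (g) (z) => a b [c d] /=; rewrite mulr0 mulr1; ring.
rewrite normrN -ltcR; apply: le_lt_trans (normc_ge_Re _) _.
rewrite normrM normCi mulr1.
near: z; apply: (@cvgr_dist_lt _ R[i]^o); last by rewrite ltcR.
exact: cvg_id.
Unshelve. all: by end_near. Qed.

Lemma real_complex_continuous : continuous ((fun x => x%:C) : R -> R[i]^o).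
Proof.
move=> x; apply/(@cvgrPdist_lt R[i] R[i]^o R (nbhs x)) => -[e e'] /= ee.
(* In the order on [R[i]], a positive radius is a positive real number. *)
have [e0 ->] : 0 < e /\ e' = 0.
  by move: ee; rewrite ltcE /= => /andP[/eqP -> ->].
near=> y.
rewrite -rmorphB normc_def /= expr0n addr0 sqrtr_sqr ltcR.
near: y; apply: cvgr_dist_lt => //; exact: cvg_id.
Unshelve. all: by end_near. Qed.

Lemma cexp_continuous : continuous (cexp : R[i]^o -> R[i]^o).
Proof.
have -> : cexp = (fun z => (expR (complex.Re z))%:C *
    ((cos (complex.Im z))%:C + 'i * (sin (complex.Im z))%:C)).
  by apply/funext => z; rewrite /cexp; apply/eqP; rewrite eq_complex /=;
     apply/andP; split; apply/eqP; ring.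
have RC (f : R -> R) (h : R[i]^o -> R) : continuous f -> continuous h ->
    continuous ((fun z => (f (h z))%:C) : R[i]^o -> R[i]^o).
  move=> cf ch z.
  apply: (@continuous_comp _ _ _ (f \o h) _ z); last exact: real_complex_continuous.
  by apply: continuous_comp; [exact: ch|exact: cf].
move=> z; apply: (@cvgM R[i] R[i]^o (nbhs (z : R[i]^o))).
  exact: (RC _ _ (@continuous_expR R) Re_continuous).
apply: (@cvgD R[i] R[i]^o R[i]^o (nbhs (z : R[i]^o))).
  exact: (RC _ _ (@continuous_cos R) Im_continuous).
apply: (@cvgM R[i] R[i]^o (nbhs (z : R[i]^o))); first exact: cvg_cst.
exact: (RC _ _ (@continuous_sin R) Im_continuous).
Qed.

(** The factor [c] serves both n^(-z), with c = -1, and the powers n^(-iz), with c = -i for a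
    natural number i. *)
Lemma natpow_continuous n (c : R[i]) :
  continuous ((fun z => natpow n (c * z)) : R[i]^o -> R[i]^o).
Proof.
have -> : (fun z => natpow n (c * z)) = cexp \o (fun z => (c * (ln (n%:R : R))%:C) * z).
  by apply/funext => z /=; rewrite natpowE mulrAC.
move=> z; apply: (@continuous_comp R[i]^o R[i]^o R[i]^o); last exact: cexp_continuous.
exact: (@mulrl_continuous R[i]).
Qed.

(** The map z -> n^(-z) does not return to its value at [g] for z near [g], z != g. This suffices if
    that value is 1; otherwise continuity keeps n^(-z) away from 1. *)
Lemma natpow_neq1_near n (g : R[i]) : (1 < n)%N ->
  \forall z \near (g : R[i]^o)^', natpow n (- z) != 1.
Proof.
move=> n1.
have l0 : 0 < ln (n%:R : R) by rewrite ln_gt0 // ltr1n.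
have inj : \forall z \near (g : R[i]^o)^', natpow n (- z) != natpow n (- g).
  near=> z; apply/eqP => E.
  have zg : g - z != 0 by rewrite subr_eq0 eq_sym; near: z;
    exact: (@nbhs_dnbhs_neq R[i]^o).
  have : cexp ((g - z) * (ln (n%:R : R))%:C) = 1.
    by rewrite -natpowE natpowD E natpowN divff // natpow_neq0.
  move/cexp_eq1.
  have -> : complex.Im ((g - z) * (ln (n%:R : R))%:C) =
      (complex.Im g - complex.Im z) * ln (n%:R : R).
    by case: (g) (z) => a b [c d] /=; rewrite mulr0 add0r.
  rewrite normrM (gtr0_norm l0) -ltr_pdivlMr //.
  move=> H; have {}H : (g - z) * (ln (n%:R : R))%:C = 0.
    apply: H; near: z; apply: nbhs_dnbhs.
    apply: (@cvgr_dist_lt R R^o R[i]^o (nbhs (g : R[i]^o)) _ _ _ (@Im_continuous g)).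
    (* The radius pi / ln n puts the imaginary part of (g - z) ln n within the range of
       [cexp_eq1]. *)
    by rewrite divr_gt0 ?pi_gt0.
  move/eqP: H; rewrite mulf_eq0 (negPf zg) /= => /eqP [] l00.
  by have := l0; rewrite l00 ltxx.
have [E|E] := eqVneq (natpow n (- g)) 1; first by rewrite -E.
apply: nbhs_dnbhs.
near=> z; rewrite -subr_eq0; near: z.
apply: (@cvgr_neq0 R[i] R[i]^o R[i]^o (nbhs (g : R[i]^o)) _
  (fun z => natpow n (- z) - 1) (natpow n (- g) - 1)); last by rewrite subr_eq0.
apply: (@cvgB R[i] R[i]^o R[i]^o (nbhs (g : R[i]^o)) _
  (fun z => natpow n (- z)) (fun=> 1)); last exact: cvg_cst.
rewrite -mulN1r; under eq_fun do rewrite -mulN1r.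
exact: natpow_continuous.
Unshelve. all: by end_near. Qed.

End ComplexExp.

(** * The quotient as a sum over factorizations, and its singularities *)

Section SigmaAk.
Variable R : realType.
Implicit Types (g z : R[i]) (a k n : nat).

Definition powN g n : R[i] := natpow n (- g).

Lemma sigmaE g n : sigma g n = divisor_sum (powN g) n.
Proof. by []. Qed.

Lemma powN1 g : powN g 1%N = 1.
Proof. exact: natpow1. Qed.

Lemma powN_mul g m n : (0 < m)%N -> (0 < n)%N -> powN g (m * n)%N = powN g m * powN g n.
Proof. exact: natpowM. Qed.

(** The product telescopes: by [factor_sum_ratio], the factor at j is D_(j+2)(k) / D_(j+1)(k) once
    its denominator is known to be nonzero. *)
Lemma sigma_quotient_factor_sum a k g : (0 < k)%N -> (0 < a)%N ->
  [forall j : 'I_a.-1, sigma g (primes_pow k j) != 0] ->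
  sigma_quotient a k g = factor_sum (powN g) a k.
Proof.
move=> k0; case: a => // a _ /=; rewrite /sigma_quotient /=.
elim: a => [_|a IH /forallP nz].
  (* The empty product equals D_1(k) = 1, where only the divisor d = k contributes. *)
  rewrite big_ord0 /=.
  under eq_bigr do rewrite expr0 mul1r.
  rewrite (bigD1_seq k) ?divisors_uniq ?divisors_id //= divnn k0 big1_seq ?addr0 //.
  move=> d /andP[dk]; rewrite -dvdn_divisors // => dvd.
  by rewrite eq_sym eqn_div ?(dvdn_gt0 k0 dvd) // mul1n (negPf dk).
rewrite big_ord_recr /= IH; last first.
  by apply/forallP => j; have := nz (widen_ord (leqnSn a) j).
by rewrite !sigmaE mulrA -(factor_sum_ratio (powN1 g) (@powN_mul g)) //
  mulfK // (nz ord_max).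
Qed.

Lemma natpow_prod (I : finType) (f : I -> nat) g : (forall i, 0 < f i)%N ->
  natpow (\prod_i f i)%N g = \prod_i natpow (f i) g.
Proof.
move=> f0.
suff [] : (0 < \prod_i f i)%N /\ natpow (\prod_i f i)%N g = \prod_i natpow (f i) g by [].
apply: (big_ind2 (fun n y => (0 < n)%N /\ natpow n g = y)) => //.
- by rewrite natpow1.
- move=> m y n z [m0 <-] [n0 <-]; rewrite muln_gt0 m0 n0; split=> //.
  exact: natpowM.
Qed.

Lemma tuple_sumE a k g :
  natpow k g *
  \sum_(t : {ffun 'I_a -> 'I_k.+1} |
        [forall i, (0 < t i)%N] && ((\prod_(i < a) (t i : nat))%N == k))
    1 / \prod_(i < a) natpow (t i) (i.+1%:R * g) =
  \sum_(t : {ffun 'I_a -> 'I_k.+1} |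
        [forall i, (0 < t i)%N] && ((\prod_(i < a) (t i : nat))%N == k))
    \prod_(i < a) powN g (t i) ^+ i.
Proof.
rewrite big_distrr; apply: eq_bigr => t /andP[/forallP t0 /eqP tk] /=.
(* Expanding k^g over the entries turns each factor into n^g / n^((i+1)g) = n^(-ig). *)
rewrite -{1}tk natpow_prod // mul1r -prodfV -big_split /=.
apply: eq_bigr => i _.
by rewrite natpowMn /powN natpowN exprS invfM mulrA divff ?natpow_neq0 // mul1r exprVn.
Qed.

(* A zero of 1 + y + ... + y^j with y = p^(-z) satisfies (p^(j+1))^(-z) = 1,
   whose solutions z are isolated. *)
Lemma sigma_pfactor_neq0_near g p j : prime p ->
  \forall z \near (g : R[i]^o)^', sigma z (p ^ j) != 0.
Proof.
move=> pp.
have n1 : (1 < p ^ j.+1)%N by rewrite -(expn0 p) ltn_exp2l ?prime_gt1.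
apply: filterS (natpow_neq1_near g n1) => z; apply: contra => /eqP E.
rewrite -/(powN z (p ^ j.+1)%N) (comp_multX (powN1 z) (@powN_mul z)) ?prime_gt0 //.
rewrite -subr_eq0 subrX1 -/(geometric_sum _ _).
rewrite -(divisor_sum_pfactor (powN1 z) (@powN_mul z)) //.
by rewrite -sigmaE E mulr0.
Qed.

(** By multiplicativity the value is a product over the primes dividing [k], and finitely many
    punctured neighbourhoods intersect in one. *)
Lemma sigma_primes_pow_neq0_near g k j : (0 < k)%N ->
  \forall z \near (g : R[i]^o)^', sigma z (primes_pow k j) != 0.
Proof.
move: k; apply: coprime_prime_ind => [|p e n pp e0 n0 cpn IH].
  by near=> z; rewrite primes_pow1 /sigma big_seq1 natpow1 oner_eq0.
have p0 := prime_gt0 pp.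
have cn : coprime p n by move: cpn; rewrite coprime_pexpl.
near=> z; rewrite primes_pow_mul ?expn_gt0 ?p0 // primes_pow_pfactor //.
rewrite sigmaE (divisor_sumM (@powN_mul z)) ?expn_gt0 ?p0 ?primes_pow_gt0 //; last first.
  exact: coprimeXl (coprime_primes_pow _ p0 n0 cn).
rewrite mulf_neq0 //; near: z; [exact: sigma_pfactor_neq0_near|exact: IH].
Unshelve. all: by end_near. Qed.

Lemma tuple_sum_continuous a k (P : pred {ffun 'I_a -> 'I_k.+1}) :
  continuous ((fun z => \sum_(t | P t) \prod_(i < a) powN z (t i) ^+ i) :
    R[i]^o -> R[i]^o).
Proof.
have cX i n : continuous ((fun z => powN z n ^+ i) : R[i]^o -> R[i]^o).
  have -> : (fun z => powN z n ^+ i) = (fun z => natpow n (- i%:R * z)).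
    by apply/funext => z; rewrite /powN -natpowMn mulrN mulNr.
  exact: natpow_continuous.
have cP (t : {ffun 'I_a -> 'I_k.+1}) :
    continuous ((fun z => \prod_(i < a) powN z (t i) ^+ i) : R[i]^o -> R[i]^o).
  move=> g; exact: (@cvg_big R[i]^o _ _ _ _ (@mul_continuous R[i]) R[i]^o
    (nbhs (g : R[i]^o)) _ (fun i z => powN z (t i) ^+ i) _ _ (fun i _ => cX i (t i) g)).
move=> g; exact: (@cvg_big R[i]^o _ _ 0 P (@add_continuous R[i]^o) R[i]^o
  (nbhs (g : R[i]^o)) (index_enum _) (fun t z => \prod_(i < a) powN z (t i) ^+ i) _
  (nbhs_filter (g : R[i]^o)) (fun t _ => cP t g)).
Qed.

End SigmaAk.

Unset Implicit Arguments.

(* Every entry of a tuple of positive integers with product k is at most k,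
   so the sum may range over the finite type of functions 'I_a -> 'I_k.+1.
   The entry at i : 'I_a is k_(i+1). *)
Theorem theorem1p6 (R : realType) (gamma : R[i]) (a k : nat)
    (ha : (0 < a)%N) (hk : (0 < k)%N) :
  sigma_ak a k gamma =
  natpow k gamma *
  \sum_(t : {ffun 'I_a -> 'I_k.+1} |
        [forall i, (0 < t i)%N] && ((\prod_(i < a) (t i : nat))%N == k))
    1 / \prod_(i < a) natpow (t i) (i.+1%:R * gamma).
Proof.
rewrite tuple_sumE /sigma_ak; case: ifPn => [nz|_].
  by rewrite sigma_quotient_factor_sum // (sum_ffun_factor _ _ hk (leqnn k)).
(* At an exceptional [gamma], it remains to show that the quotient converges to the tuple sum,
   limits being unique in a Hausdorff space. *)
apply: (@cvg_lim R[i]^o); first exact: norm_hausdorff.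
have nz : \forall z \near (gamma : R[i]^o)^',
    forall j : 'I_a.-1, sigma z (primes_pow k j) != 0.
  by apply: filter_forall => j; exact: sigma_primes_pow_neq0_near.
(* The tuple sum tends to its value at [gamma], also along the punctured neighbourhood, where it
   eventually coincides with the quotient. *)
apply: cvg_trans (cvg_trans (cvg_app _ (@nbhs_dnbhs R[i]^o gamma))
  (@tuple_sum_continuous _ _ _ _ gamma)).
apply: near_eq_cvg; apply: filterS nz => z /forallP nz.
by rewrite sigma_quotient_factor_sum // (sum_ffun_factor _ _ hk (leqnn k)).
Qed.
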